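(* Let $P$ be a probability measure on $\mathcal X$ with embedding $P_k$. The constrained quantization problem $$\begin{aligned}\text{minimize}\quad&\|P_k-P_k^n\|_k\\\text{in}\quad&\boldsymbol p=[p_1,\dots,p_n]\ \text{and}\ \boldsymbol x=[x_1,\dots,x_n],\\\text{subject to}\quad&\sum_{i=1}^np_i=1,\\&p_i\ge0,\ \text{and}\\&x_i\in\mathcal X\ \text{for}\ i=1,\dots,n,\end{aligned}$$ where $P_k^n(\cdot)=\sum_{i=1}^np_i\,k(x_i,\cdot)$ is the embedding of the discrete measure $P^n=\sum_{i=1}^np_i\,\delta_{x_i}$, can be reformulated as the unconstrained optimization problem involving the expectation with respect to the product measure $P\otimes P$ $$\min_{\boldsymbol x=[x_1,\dots,x_n]\in\mathcal X^n}\ \mathbb E_{(\xi,\xi')\sim P\otimes P}\bigl[c(\boldsymbol x,\xi,\xi')\bigr],$$ where $$\begin{aligned}c(\boldsymbol x,\xi,\xi')={}&k(\xi,\xi')-k(\xi,\boldsymbol x)^\top\boldsymbol K(\boldsymbol x)^{-1}k(\xi',\boldsymbol x)\\&+\frac{1}{\boldsymbol 1^\top\boldsymbol K(\boldsymbol x)^{-1}\boldsymbol 1}\bigl(1-\boldsymbol 1^\top\boldsymbol K(\boldsymbol x)^{-1}k(\xi,\boldsymbol x)\bigr)\cdot\bigl(1-\boldsymbol 1^\top\boldsymbol K(\boldsymbol x)^{-1}k(\xi',\boldsymbol x)\bigr)\end{aligned}$$ is the cost function. The expectation is with respect to the probability measure $P\otimes P$, and $\boldsymbol x=[x_1,\dots,x_n]$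 represents the supporting points.
   Context: $(\mathcal H_k,\|\cdot\|_k)$ is a reproducing kernel Hilbert space of functions on $\mathcal X$ with kernel $k$, whose inner product satisfies $\langle k(x,\cdot),k(y,\cdot)\rangle_k=k(x,y)$. The kernel embedding of a measure $\mu$ on $\mathcal X$ is $\mu_k(\cdot)=\int_{\mathcal X}k(\cdot,\xi)\,\mu(\mathrm d\xi)$; in particular $P_k(\cdot)=\int_{\mathcal X}k(\cdot,\xi)\,P(\mathrm d\xi)$. $\delta_x$ is the Dirac measure located at $x$. The product measure is the independent product, defined by $(P\otimes Q)(A\times B)=P(A)\cdot Q(B)$. Notation: $\boldsymbol K(\boldsymbol x)=\bigl(k(x_i,x_j)\bigr)_{i,j=1}^n$ is the kernel matrix, with inverse $\boldsymbol K(\boldsymbol x)^{-1}$; $k(\xi,\boldsymbol x)=\bigl(k(\xi,x_1),\dots,k(\xi,x_n)\bigr)$, treated as a column vector in $\mathbb R^n$; and $\boldsymbol 1=[1,\dots,1]$ is the $n$-dimensional column vector of ones.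
   Formalization: False as stated due to p_i≥0: proved for weights summing to 1; with p_i≥0, assuming that constraint leaves the infimum unchanged. K(x) is assumed invertible for distinct points, n distinct points exist, k is P⊗P-integrable; min E[c] runs over x with K(x) invertible. *)

(* Defs.v *)
(* MathComp / MathComp-Analysis world. *)
From HB Require Import structures.
From mathcomp Require Import all_boot all_order all_algebra.
From mathcomp Require Import all_classical all_reals all_analysis.

Set Implicit Arguments.
Unset Strict Implicit.
Unset Printing Implicit Defensive.

Import Order.TTheory GRing.Theory Num.Theory.
Import numFieldNormedType.Exports.

Local Open Scope classical_set_scope.
Local Open Scope ring_scope.

(* A Hilbert space of functions on [X]: its elements are identified with       *)
(* functions through the injective linear map [rk_eval]; [rk_ker x] is the     *)
(* element k(x, .).  Completeness is part of [completeNormedModType].          *)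
Record rkhs (R : realType) (X : Type) (k : X -> X -> R) := RKHS {
  rk_space :> completeNormedModType R;
  rk_dot : {dot rk_space for idfun};
  rk_norm : forall f : rk_space, `|f| ^+ 2 = rk_dot f f;
  rk_eval : rk_space -> X -> R;
  rk_eval_linear : forall (a : R) (f g : rk_space) (y : X),
    rk_eval (a *: f + g) y = a * rk_eval f y + rk_eval g y;
  rk_eval_inj : injective rk_eval;
  rk_ker : X -> rk_space;
  rk_kerE : forall x y : X, rk_eval (rk_ker x) y = k x y;
  rk_reproducing : forall (f : rk_space) (x : X),
    rk_dot f (rk_ker x) = rk_eval f x }.

(* [f] is the function y |-> \int k(y, xi) mu(dxi). *)
Definition kernel_embedding d (X : measurableType d) (R : realType)
    (k : X -> X -> R) (H : rkhs k) (mu : {measure set X -> \bar R}) (f : H) :=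
  forall y : X, mu.-integrable [set: X] (fun xi => (k y xi)%:E) /\
    (rk_eval f y)%:E = (\int[mu]_xi (k y xi)%:E)%E.

Section Quantization.
Variables (R : realType) (X : Type) (k : X -> X -> R) (n : nat).
Implicit Types (x : 'I_n -> X) (p : 'cV[R]_n).

Definition kermat x : 'M[R]_n := \matrix_(i, j) k (x i) (x j).

Definition kervec x (xi : X) : 'cV[R]_n := \col_i k xi (x i).

Definition ones : 'cV[R]_n := const_mx 1.

Definition cost x (xi xi' : X) : R :=
  let Kinv := invmx (kermat x) in
  k xi xi'
  - ((kervec x xi)^T *m Kinv *m kervec x xi') 0 0
  + (1 / (ones^T *m Kinv *m ones) 0 0)
    * (1 - (ones^T *m Kinv *m kervec x xi) 0 0)
    * (1 - (ones^T *m Kinv *m kervec x xi') 0 0).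

(* [invmx] is meaningful only on invertible matrices, so the cost function is  *)
(* defined at [x] only when the kernel matrix is invertible.                   *)
Definition cost_dom x := kermat x \in unitmx.

Definition sum_one p := \sum_(i < n) p i 0 = 1.

Definition simplex p := sum_one p /\ forall i, 0 <= p i 0.

Definition discrete_embedding (H : rkhs k) p x : H :=
  \sum_(i < n) p i 0 *: rk_ker H (x i).

Definition quant_error (H : rkhs k) (Pk : H) p x : R :=
  `|Pk - discrete_embedding H p x|.

Definition quant_inf (H : rkhs k) (Pk : H) (feasible : 'cV[R]_n -> Prop) : R :=
  inf [set r | exists p x, feasible p /\ r = quant_error Pk p x].

Definition quant_solution (H : rkhs k) (Pk : H) p x :=
  simplex p /\
  forall q y, simplex q -> quant_error Pk p x <= quant_error Pk q y.

End Quantization.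

Definition expected_cost d (X : measurableType d) (R : realType)
    (k : X -> X -> R) (P : probability X R) n (x : 'I_n -> X) : \bar R :=
  ('E_(P \x P)%E[fun z : X * X => cost k x z.1 z.2])%E.

Definition cost_inf d (X : measurableType d) (R : realType)
    (k : X -> X -> R) (P : probability X R) n : \bar R :=
  ereal_inf [set expected_cost k P x | x in [set x : 'I_n -> X | cost_dom k x]].

Definition cost_solution d (X : measurableType d) (R : realType)
    (k : X -> X -> R) (P : probability X R) n (x : 'I_n -> X) :=
  cost_dom k x /\ forall y : 'I_n -> X, cost_dom k y ->
    (expected_cost k P x <= expected_cost k P y)%E.

(* Allowing negative weights does not decrease the optimal quantization error. *)
Definition sign_constraint_inactive (R : realType) (X : Type)
    (k : X -> X -> R) n (H : rkhs k) (Pk : H) :=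
  quant_inf Pk (@simplex R n) = quant_inf Pk (@sum_one R n).

(* Main.v *)
Require Import Defs.
From HB Require Import structures.
From mathcomp Require Import all_boot all_order all_algebra.
From mathcomp Require Import all_classical all_reals all_analysis.
From mathcomp Require Import measurable_realfun ring lra.

Set Implicit Arguments.
Unset Strict Implicit.
Unset Printing Implicit Defensive.

Import Order.TTheory GRing.Theory Num.Theory.
Import numFieldNormedType.Exports.

Local Open Scope classical_set_scope.
Local Open Scope ring_scope.

(** For fixed points [x] with an invertible kernel matrix [K], the squared error
    is a convex quadratic function of the weights,
      |Pk - sum_i p_i k(x_i, .)|^2 = |Pk|^2 - 2 p^T b + p^T K p,
    with [b_i = Pk(x_i)].  On the hyperplane [sum_i p_i = 1] it is minimized by
    [p = K^-1 (b + lam 1)], with the Lagrange multiplier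
    [lam = (1 - 1^T K^-1 b) / (1^T K^-1 1)]: the residual then takes the same
    value [- lam] at every [x_i], so it is orthogonal to every change of the
    weights that preserves their sum, and Pythagoras ([quant_error_split])
    gives optimality.  The minimum ([quant_error_opt]) is
      |Pk|^2 - b^T K^-1 b + (1 - 1^T K^-1 b)^2 / (1^T K^-1 1).
    Since [b] is the mean of [k(xi, x)], independence of [xi] and [xi'] turns
    this value into the expectation of the cost ([expected_costE]), as soon as
      |Pk|^2 = E k(xi, xi').

    This last identity ([mean_embedding_norm]) is the analytic core.  The
    embedding [Pk] is only known through its values [Pk(y) = E k(y, xi)], and
    neither [k(xi, xi)] nor its square root is supposed integrable, so [Pk] need
    not be a Bochner integral.  It is approached by truncation: let [w_m] be the
    indicator of [k(x, x) <= m^2].  Then [f |-> E w_m(xi) f(xi)] is a bounded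
    functional on the functions of the space that are measurable, hence is
    represented by some [g_m] ([weighted_mean_embedding], an application of
    [riesz_closed_subspace]).  By Fubini, the inner product of [g_m] and [g_n]
    is [E w_m(xi) w_n(xi') k(xi, xi')], which tends to [E k(xi, xi')] by
    dominated convergence.  So [g_m] is a Cauchy sequence; its limit has the
    values of [Pk], hence is [Pk], and the squared norms pass to the limit.

    There remains to compare the infima.  Points that are not distinct may have
    a singular kernel matrix, but merging equal atoms and adding new points of
    weight zero gives distinct points, at which the kernel matrix is invertible,
    without changing the discrete measure ([merge_atoms]).  When the sign
    constraint is inactive, the simplex has the same infimum, and the
    correspondence of the solutions follows. *)

(** * Real Hilbert spaces *)

Section Hilbert.
Context {R : realType} {V : completeNormedModType R} (dot : {dot V for idfun}).
Hypothesis dot_norm : forall f : V, `|f| ^+ 2 = dot f f.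
Implicit Types (f g h : V) (S : set V) (L : V -> R).

Lemma dotC f g : dot f g = dot g f.
Proof. by rewrite hermC expr0 mul1r. Qed.

Lemma dotZr a f g : dot f (a *: g) = a * dot f g.
Proof. by rewrite linearZr_LR. Qed.

Lemma dotBl f g h : dot (f - g) h = dot f h - dot g h.
Proof. by rewrite linearBl. Qed.

Lemma dotBr f g h : dot h (f - g) = dot h f - dot h g.
Proof. by rewrite linearBr. Qed.

Lemma dot_sumr f (I : Type) (r : seq I) (F : I -> V) :
  dot f (\sum_(i <- r) F i) = \sum_(i <- r) dot f (F i).
Proof. by rewrite linear_sumr. Qed.

Lemma sqr_normD f g : `|f + g| ^+ 2 = `|f| ^+ 2 + 2 * dot f g + `|g| ^+ 2.
Proof. by rewrite !dot_norm linearDl !linearDr /= (dotC g f); ring. Qed.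

Lemma sqr_normB f g : `|f - g| ^+ 2 = `|f| ^+ 2 - 2 * dot f g + `|g| ^+ 2.
Proof. by rewrite sqr_normD linearNr normrN; ring. Qed.

(** Cauchy-Schwarz, read off the square of the triangle inequality. *)
Lemma ler_norm_dot f g : `|dot f g| <= `|f| * `|g|.
Proof.
have up u v : dot u v <= `|u| * `|v|.
  have : `|u + v| ^+ 2 <= (`|u| + `|v|) ^+ 2.
    by rewrite lerXn2r ?nnegrE ?addr_ge0// ler_normD.
  by rewrite sqr_normD sqrrD; lra.
rewrite ler_norml up andbT.
by have := up (- f) g; rewrite linearNl normrN; lra.
Qed.

(** The form in which both minimizing sequences and truncations are shown to
    converge: their squared distances are controlled by errors in energy. *)
Lemma sqr_norm_cauchy (u : V^nat) (e : R^nat) :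
  (forall m n, `|u m - u n| ^+ 2 <= e m + e n) -> e @ \oo --> (0 : R) ->
  cvgn u.
Proof.
move=> ue e0; apply: cauchy_cvg; apply: cauchy_exP => r r0.
have : \forall n \near \oo, `|e n| < r ^+ 2 / 2.
  have /cvgr0Pnorm_lt := e0; apply; first by rewrite divr_gt0 ?exprn_gt0.
case=> N _ eN; exists (u N), N => //= n Nn.
rewrite -ball_normE /ball_ /=.
rewrite -(@ltr_pXn2r _ 2) ?nnegrE ?(ltW r0)//.
apply: le_lt_trans (ue _ _) _.
have /= := eN _ Nn; have /= := eN N (leqnn N).
by rewrite !ltr_norml => /andP[_ ?] /andP[_ ?]; lra.
Qed.

(** Riesz representation on a sequentially closed subspace, by minimizing the
    energy [J f = |f|^2 - 2 L f]: the parallelogram identity makes minimizing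
    sequences Cauchy, and the first order condition at the minimizer [g] is
    [dot g f = L f].  [L] is only required to be linear on [S], as integration
    is on the functions that can be integrated. *)
Lemma riesz_closed_subspace S L (C : R) :
  S 0 ->
  (forall a f g, S f -> S g -> S (a *: f + g)) ->
  (forall (u : V^nat) f, (forall n, S (u n)) -> u @ \oo --> f -> S f) ->
  (forall a f g, S f -> S g -> L (a *: f + g) = a * L f + L g) ->
  (forall f, S f -> `|L f| <= C * `|f|) ->
  exists2 g, S g & forall f, S f -> dot g f = L f.
Proof.
move=> S0 Slin Sclosed Llin Lbnd.
pose J f := `|f| ^+ 2 - 2 * L f.
have Jlin (a : R) f g : S f -> S g ->
    J (a *: f + g) = J g + 2 * a * (dot g f - L f) + a ^+ 2 * `|f| ^+ 2.
  move=> Sf Sg; rewrite /J Llin// sqr_normD normrZ exprMn real_normK ?num_real//.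
  by rewrite dotC dotZr; ring.
have Jge f : S f -> - (C ^+ 2) <= J f.
  move=> /Lbnd; rewrite ler_norml /J => /andP[_ Lf].
  have : 0 <= (`|f| - C) ^+ 2 by exact: sqr_ge0.
  by rewrite sqrrB; lra.
pose E := [set J f | f in S].
have E0 : E !=set0 by exists (J 0), 0.
have El : has_lbound E by exists (- (C ^+ 2)) => _ [f Sf <-]; exact: Jge.
have Einf f : S f -> inf E <= J f by move=> Sf; apply: ge_inf => //; exists f.
have /choice [u uP] n : exists f, S f /\ J f < inf E + n.+1%:R^-1.
  have [|_ [f Sf <-] Jf] := @inf_adherent _ E n.+1%:R^-1 _ (conj E0 El).
    by rewrite invr_gt0.
  by exists f.
have Su n : S (u n) by case: (uP n).
have ucvg : cvgn u.
  apply: (@sqr_norm_cauchy _ (fun n => 2 * n.+1%:R^-1)); last first.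
    rewrite -(mulr0 2); apply: cvgM; first exact: cvg_cst.
    exact: cvg_harmonic.
  move=> m n.
  (* The midpoint is written [u n + (u m - u n) / 2] to let [Jlin] expand [J]. *)
  have Smid : S (2^-1 *: (u m - u n) + u n).
    apply: (Slin) => //; rewrite -[u m]scale1r.
    have := Slin (-1) (u n) (u m) (Su n) (Su m).
    by rewrite scaleN1r addrC scale1r.
  have Sd : S (u m - u n).
    by have := Slin (-1) (u n) (u m) (Su n) (Su m); rewrite scaleN1r addrC.
  have := Einf _ Smid; rewrite Jlin//.
  have : J (u m) = J (u n) + 2 * (dot (u n) (u m - u n) - L (u m - u n))
         + `|u m - u n| ^+ 2.
    have := Jlin 1 _ _ Sd (Su n).
    by rewrite scale1r subrK mulr1 expr1n mul1r.
  have [_ Jm] := uP m; have [_ Jn] := uP n.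
  set x := `|_| ^+ 2; set y := dot _ _ - _; move=> E1 E2.
  have : x = 2 * (J (u m) + J (u n))
             - 4 * (J (u n) + 2 * 2^-1 * y + 2^-1 ^+ 2 * x).
    by rewrite E1; field.
  move: Jm Jn E2 => /=; set a := m.+1%:R^-1; set b := n.+1%:R^-1; lra.
pose g := limn u.
have ug : u @ \oo --> g by [].
have Sg : S g by exact: Sclosed ug.
have Jg : J g <= inf E.
  have Jug n : J g - 2 * (C * `|g - u n|) - (`|g| ^+ 2 - `|u n| ^+ 2) <=
      inf E + n.+1%:R^-1.
    have [_ /ltW] := uP n; apply: le_trans.
    have Sd : S (g - u n).
      by have := Slin (-1) (u n) g (Su n) Sg; rewrite scaleN1r addrC.
    have := Lbnd _ Sd; rewrite ler_norml => /andP[Lb _].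
    have := Llin 1 _ _ Sd (Su n); rewrite scale1r subrK mul1r /J => ->.
    lra.
  have cvgl :
      J g - 2 * (C * `|g - u n|) - (`|g| ^+ 2 - `|u n| ^+ 2) @[n --> \oo] -->
      J g - 2 * (C * `|g - g|) - (`|g| ^+ 2 - `|g| ^+ 2).
    apply: cvgB; [apply: cvgB; first exact: cvg_cst|].
      apply: cvgM; first exact: cvg_cst.
      apply: cvgM; first exact: cvg_cst.
      by apply: cvg_norm; apply: cvgB => //; exact: cvg_cst.
    apply: cvgB; first exact: cvg_cst.
    by rewrite expr2; under eq_fun do rewrite expr2; apply: cvgM; exact: cvg_norm.
  have cvgr : inf E + n.+1%:R^-1 @[n --> \oo] --> inf E + 0.
    by apply: cvgD; [exact: cvg_cst|exact: cvg_harmonic].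
  have := ler_cvg_to cvgl cvgr.
  rewrite subrr normr0 mulr0 mulr0 subr0 subrr subr0 addr0.
  by apply; near=> n; exact: Jug.
exists g => // f Sf; apply/eqP; rewrite -subr_eq0; apply/eqP.
set y := _ - _.
have ge0 (a : R) : 0 <= 2 * a * y + a ^+ 2 * `|f| ^+ 2.
  have := Einf _ (Slin a _ _ Sf Sg); rewrite Jlin// -/y; lra.
have Q : 0 <= `|f| ^+ 2 by exact: sqr_ge0.
set q := `|f| ^+ 2 in ge0 Q.
have q1 : 0 < 1 + q by lra.
(* The minimizing step is [- y / q]; adding 1 avoids the case [q = 0]. *)
have := ge0 (- y / (1 + q)).
have -> : 2 * (- y / (1 + q)) * y + (- y / (1 + q)) ^+ 2 * q =
          - (y ^+ 2 * ((2 + q) / (1 + q) ^+ 2)).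
  by field; lra.
rewrite oppr_ge0 pmulr_lle0 ?divr_gt0 ?exprn_gt0 //; last lra.
by move=> y0; apply/eqP; rewrite -sqrf_eq0 eq_le y0 sqr_ge0.
Unshelve. all: by end_near. Qed.

End Hilbert.

(** * Integrable functions with a given integral *)

Section HasIntegral.
Context {d : measure_display} {T : measurableType d} {R : realType}.
Variable mu : {measure set T -> \bar R}.
Implicit Types (f g : T -> R) (a b c : R).

(** Carrying the value with the integrability lets linear expressions be
    integrated with real arithmetic only, away from extended reals. *)
Definition has_integral f c :=
  mu.-integrable [set: T] (EFin \o f) /\ (\int[mu]_x (f x)%:E)%E = c%:E.

Lemma integrable_has_integral f :
  mu.-integrable [set: T] (EFin \o f) -> has_integral f (\int[mu]_x f x).
Proof.
by move=> intf; split=> //; rewrite /Rintegral fineK//; exact: integrable_fin_num.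
Qed.

Lemma has_integral_ext f g c : f =1 g -> has_integral f c -> has_integral g c.
Proof. by move=> /funext ->. Qed.

Lemma has_integralD f g a b : has_integral f a -> has_integral g b ->
  has_integral (fun x => f x + g x) (a + b).
Proof.
move=> [If If'] [Ig Ig']; split.
  by have := integrableD measurableT If Ig; apply: eq_integrable.
under eq_integral do rewrite EFinD.
by rewrite integralD//= If' Ig'.
Qed.

Lemma has_integralZ f c a : has_integral f c ->
  has_integral (fun x => a * f x) (a * c).
Proof.
move=> [If If']; split.
  by have := integrableZl measurableT a If; apply: eq_integrable.
under eq_integral do rewrite EFinM.
by rewrite integralZl//= If'.
Qed.

Lemma has_integralB f g a b : has_integral f a -> has_integral g b ->
  has_integral (fun x => f x - g x) (a - b).
Proof.
move=> hf /(@has_integralZ _ _ (-1)) hg; rewrite -mulN1r.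
by apply: has_integral_ext (has_integralD hf hg) => x; rewrite mulN1r.
Qed.

Lemma has_integral0 : has_integral (fun=> 0) 0.
Proof. by split; [exact: integrable0|rewrite integral0]. Qed.

Lemma has_integral_sum (I : Type) (s : seq I) (f : I -> T -> R) (c : I -> R) :
  (forall i, has_integral (f i) (c i)) ->
  has_integral (fun x => \sum_(i <- s) f i x) (\sum_(i <- s) c i).
Proof.
move=> fc; elim: s => [|i s IH].
  by rewrite big_nil; apply: has_integral_ext has_integral0 => x; rewrite big_nil.
rewrite big_cons; apply: has_integral_ext (has_integralD (fc i) IH) => x.
by rewrite big_cons.
Qed.

Lemma has_integral_uniq f a b : has_integral f a -> has_integral f b -> a = b.
Proof. by move=> [_ fa] [_]; rewrite fa => -[]. Qed.

Lemma has_integral_le f g a b : has_integral f a -> has_integral g b ->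
  (forall x, f x <= g x) -> a <= b.
Proof.
move=> [If fa] [Ig gb] fg; rewrite -lee_fin -fa -gb.
by apply: le_integral => // x _; rewrite lee_fin.
Qed.

Lemma has_integral_norm_le f g a b : has_integral f a -> has_integral g b ->
  (forall x, `|f x| <= g x) -> `|a| <= b.
Proof.
move=> fa gb fg; rewrite ler_norml; apply/andP; split.
  have gN := has_integralZ (-1) gb; rewrite -mulN1r.
  apply: (has_integral_le gN fa) => x; rewrite mulN1r.
  by have := fg x; rewrite ler_norml => /andP[].
apply: (has_integral_le fa gb) => x.
by have := fg x; rewrite ler_norml => /andP[].
Qed.

Lemma has_integral_dominated f g c : has_integral g c ->
  measurable_fun setT f -> (forall x, `|f x| <= g x) ->
  has_integral f (\int[mu]_x f x).
Proof.
move=> [Ig _] mf fg; apply: integrable_has_integral.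
apply: le_integrable Ig => //; first exact/measurable_EFinP.
by move=> x _ /=; rewrite lee_fin (le_trans (fg x))// ler_norm.
Qed.

Lemma has_integral_measurable f c : has_integral f c -> measurable_fun setT f.
Proof. by move=> [/(measurable_int mu)/measurable_EFinP]. Qed.

Lemma has_integral_cvg (u : nat -> T -> R) (a : R^nat) f g b c :
  (forall n, has_integral (u n) (a n)) -> has_integral f b ->
  has_integral g c -> (forall n x, `|u n x| <= g x) ->
  (forall x, u n x @[n --> \oo] --> f x) -> a @ \oo --> b.
Proof.
move=> ua [If fb] [Ig gc] ug uf.
have : (\int[mu]_x (u n x)%:E)%E @[n --> \oo] --> (\int[mu]_x (f x)%:E)%E.
  apply: (@dominated_cvg _ _ _ mu setT measurableT
    (fun n x => (u n x)%:E) _ (EFin \o g)) => //.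
  - by move=> n; apply/measurable_EFinP; exact: has_integral_measurable (ua n).
  - by move=> x _; apply/cvg_EFin; [exact: nearW|exact: uf].
  - by move=> n x _; rewrite /= lee_fin.
rewrite fb; under eq_fun do rewrite (ua _).2.
by move=> /fine_cvg.
Qed.

End HasIntegral.

Section ProductMeasure.
Context {d : measure_display} {X : measurableType d} {R : realType}.
Variable P : probability X R.

Lemma has_integral_cst c : has_integral P (fun=> c) c.
Proof.
split; first exact: (finite_measure_integrable_cst P c measurableT).
by rewrite integral_cst//= probability_setT mule1.
Qed.

(** Fubini's theorem when every section is integrable; in general, the inner
    integral is only defined almost everywhere. *)
Lemma has_integral_iterated (f : X * X -> R) (g : X -> R) c :
  has_integral (P \x P)%E f c ->
  (forall x, has_integral P (fun y => f (x, y)) (g x)) ->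
  has_integral P g c.
Proof.
move=> [If Ifc] fg.
have gE : fubini_F P (EFin \o f) = EFin \o g.
  by apply/funext => x; rewrite /fubini_F/=; case: (fg x).
split; first by rewrite -gE; exact: integrable_fubini_F If.
by rewrite -Ifc -(integral12_prod_meas1 If) gE.
Qed.

(** The expectation of a product of independent variables; Tonelli's theorem
    provides the integrability that Fubini's theorem needs. *)
Lemma has_integral_prod (f g : X -> R) a b :
  has_integral P f a -> has_integral P g b ->
  has_integral (P \x P)%E (fun z => f z.1 * g z.2) (a * b).
Proof.
move=> [If Ifa] [Ig Igb].
have mf : measurable_fun setT f by move/integrableP : If => [/measurable_EFinP].
have mg : measurable_fun setT g by move/integrableP : Ig => [/measurable_EFinP].
have mfg : measurable_fun setT (fun z : X * X => f z.1 * g z.2).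
  by apply: measurable_funM; apply: measurableT_comp.
have Int : (P \x P)%E.-integrable setT (fun z : X * X => (f z.1 * g z.2)%:E).
  apply/integrableP; split; first exact/measurable_EFinP.
  rewrite fubini_tonelli1//=; last first.
    by apply/measurable_EFinP; apply: measurableT_comp mfg.
  rewrite /fubini_F/=.
  have -> : (fun x => \int[P]_y `|f x * g y|%:E)%E =
            (fun x => (\int[P]_y `|g y|%:E) * `|f x|%:E)%E.
    apply/funext => x; under eq_integral do rewrite normrM EFinM.
    rewrite ge0_integralZl//= 1?muleC//.
    by apply/measurable_EFinP; exact: measurableT_comp.
  rewrite ge0_integralZl//=; last 2 first.
    by apply/measurable_EFinP; exact: measurableT_comp.
    by apply: integral_ge0.
  have /integrableP [_ /= Hf] := If; have /integrableP [_ /= Hg] := Ig.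
  apply: lte_mul_pinfty => //; first exact: integral_ge0.
  by rewrite ge0_fin_numE// integral_ge0.
split=> //.
rewrite -(integral12_prod_meas1 Int) /fubini_F/=.
under eq_integral => x _.
  under eq_integral do rewrite EFinM.
  rewrite integralZl//= Igb muleC.
  over.
by rewrite integralZl//= Ifa muleC.
Qed.

End ProductMeasure.

(** * The norm of a mean embedding *)

Section MeanEmbedding.
Context {R : realType} {d : measure_display} {X : measurableType d}.
Context {k : X -> X -> R} (H : rkhs k) (P : probability X R).
Implicit Types (f g : H) (x y : X).
Local Notation dot := (rk_dot H).
Local Notation phi := (rk_ker H).
Local Notation norm := (@rk_norm R X k H).

Lemma rk_ker_dot x y : dot (phi x) (phi y) = k x y.
Proof. by rewrite rk_reproducing rk_kerE. Qed.

Lemma rk_ker_norm x : `|phi x| ^+ 2 = k x x.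
Proof. by rewrite norm rk_ker_dot. Qed.

Lemma rk_kerC x y : k x y = k y x.
Proof. by rewrite -!rk_ker_dot dotC. Qed.

Lemma rk_eval_norm_le f y : `|rk_eval f y| <= `|f| * `|phi y|.
Proof. by rewrite -rk_reproducing; exact: (ler_norm_dot norm). Qed.

Lemma rk_evalB f g y : rk_eval (f - g) y = rk_eval f y - rk_eval g y.
Proof. by rewrite -!rk_reproducing linearBl. Qed.

Lemma rk_eval_cvg (u : H^nat) f y :
  u @ \oo --> f -> rk_eval (u n) y @[n --> \oo] --> rk_eval f y.
Proof.
move=> uf; apply/subr_cvg0; apply: norm_cvg0.
have cvgb : `|u n - f| * `|phi y| @[n --> \oo] --> (0 : R).
  rewrite -(mul0r `|phi y|); apply: cvgM; last exact: cvg_cst.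
  by rewrite -(@normr0 _ H); apply: cvg_norm; apply/subr_cvg0.
apply: squeeze_cvgr (@cvg_cst _ _ _ _ _) cvgb; apply: nearW => n.
by rewrite normr_ge0 /= -rk_evalB rk_eval_norm_le.
Qed.

(** A weight [w] that makes [w(x) sqrt(k(x, x))] bounded has an embedding.  The
    Riesz lemma is applied to the functions of the space that are measurable:
    all the [k(y, .)] are, and pointwise limits preserve measurability, whereas
    an arbitrary element of the space could not be integrated as it stands. *)
Lemma weighted_mean_embedding (w : X -> R) (C : R) :
  (forall y, measurable_fun setT (k y)) -> measurable_fun setT w ->
  (forall x, `|w x| * `|phi x| <= C) ->
  exists2 g : H, measurable_fun setT (rk_eval g) &
    forall f, measurable_fun setT (rk_eval f) ->
      has_integral P (fun x => w x * rk_eval f x) (dot g f).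
Proof.
move=> mk mw wC.
pose S : set H := [set f | measurable_fun setT (rk_eval f)].
pose L f := \int[P]_x (w x * rk_eval f x).
have wf f x : `|w x * rk_eval f x| <= C * `|f|.
  rewrite normrM; apply: le_trans (ler_wpM2r (normr_ge0 f) (wC x)).
  by rewrite -mulrA ler_wpM2l// mulrC rk_eval_norm_le.
have Lint f : S f -> has_integral P (fun x => w x * rk_eval f x) (L f).
  move=> Sf.
  apply: has_integral_dominated (has_integral_cst P (C * `|f|)) _ _ => //.
  exact: measurable_funM.
have Slin (a : R) f g : S f -> S g -> S (a *: f + g).
  rewrite /S /= => Sf Sg.
  have -> : rk_eval (a *: f + g) = (fun x => a * rk_eval f x + rk_eval g x).
    by apply/funext => x; rewrite rk_eval_linear.
  by apply: measurable_funD => //; apply: measurable_funM.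
have [g Sg gL] : exists2 g, S g & forall f, S f -> dot g f = L f.
  apply: (riesz_closed_subspace norm (C := C)) => //.
  - rewrite /S /=; have -> : rk_eval (0 : H) = (fun=> 0).
      by apply/funext => x; rewrite -rk_reproducing linear0l.
    exact: measurable_cst.
  - move=> u f Su uf; apply: (measurable_fun_cvg Su) => x _.
    exact: rk_eval_cvg.
  - move=> a f g Sf Sg.
    apply: (has_integral_uniq (Lint _ (Slin a f g Sf Sg))).
    apply: has_integral_ext
      (has_integralD (has_integralZ a (Lint _ Sf)) (Lint _ Sg)) => x.
    by rewrite rk_eval_linear; ring.
  - move=> f Sf; apply: has_integral_norm_le (Lint _ Sf) (has_integral_cst P _) _.
    exact: wf.
by exists g => // f Sf; rewrite gL//; exact: Lint.
Qed.

(** Truncation where [k(x, x)] is large makes the embeddings [g n] available, and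
    dominated convergence shows that they converge in norm to [Pk]. *)
Lemma mean_embedding_norm (Pk : H) :
  kernel_embedding P Pk ->
  (P \x P)%E.-integrable [set: X * X] (fun z => (k z.1 z.2)%:E) ->
  has_integral (P \x P)%E (fun z => k z.1 z.2) (`|Pk| ^+ 2).
Proof.
move=> PkE kint.
have kP y : has_integral P (k y) (rk_eval Pk y).
  by have [Iy yE] := PkE y; split; rewrite ?yE.
have mk y : measurable_fun setT (k y) := has_integral_measurable (kP y).
have kI := integrable_has_integral kint; set I := Rintegral _ _ _ in kI.
have mkk := has_integral_measurable kI.
pose w n x : R := if k x x <= n%:R ^+ 2 then 1 else 0.
have w01 n x : 0 <= w n x <= 1 by rewrite /w; case: ifP => _; rewrite ?ler01 ?lexx.
have mw n : measurable_fun setT (w n).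
  apply: measurable_fun_ifT => //; apply: measurable_fun_ler => //.
  exact: (measurableT_comp mkk (measurable_fun_pair _ _)).
have wphi n x : `|w n x| * `|phi x| <= n%:R.
  rewrite /w; case: ifPn => [kx|_]; last by rewrite normr0 mul0r.
  by rewrite normr1 mul1r -(@ler_pXn2r _ 2)// ?nnegrE// rk_ker_norm.
have w1 x : w n x @[n --> \oo] --> (1 : R).
  apply: cvg_near_cst; near=> n; rewrite /w ifT//.
  rewrite -rk_ker_norm lerXn2r ?nnegrE//.
  by near: n; exact: nbhs_infty_ger.
have /choice [g gP] n : exists g : H, measurable_fun setT (rk_eval g) /\
    forall f, measurable_fun setT (rk_eval f) ->
      has_integral P (fun x => w n x * rk_eval f x) (dot g f).
  have [g mg gw] := weighted_mean_embedding mk (mw n) (wphi n).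
  by exists g.
have mphi y : measurable_fun setT (rk_eval (phi y)).
  by have -> : rk_eval (phi y) = k y by apply/funext => x; exact: rk_kerE.
have gE n x : has_integral P (fun y => w n y * k x y) (rk_eval (g n) x).
  rewrite -rk_reproducing; apply: has_integral_ext ((gP n).2 _ (mphi x)) => y.
  by rewrite rk_kerE.
pose W m n (z : X * X) := w m z.1 * w n z.2.
have W01 m n z : 0 <= W m n z <= 1.
  by rewrite /W; have /andP[? ?] := w01 m z.1; have /andP[? ?] := w01 n z.2; nra.
have mw1 n : measurable_fun setT (fun z : X * X => w n z.1).
  exact: (measurableT_comp (mw n) measurable_fst).
have mw2 n : measurable_fun setT (fun z : X * X => w n z.2).
  exact: (measurableT_comp (mw n) measurable_snd).
have knI : has_integral (P \x P)%E (fun z => `|k z.1 z.2|)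
    (\int[(P \x P)%E]_z `|k z.1 z.2|).
  exact/integrable_has_integral/integrable_norm.
(* [c m n] is the inner product of the truncated embeddings. *)
pose c m n := \int[(P \x P)%E]_z (W m n z * k z.1 z.2).
have cI m n :
    has_integral (P \x P)%E (fun z => W m n z * k z.1 z.2) (c m n).
  apply: (has_integral_dominated knI).
    by apply: measurable_funM => //; exact: measurable_funM.
  move=> z; rewrite normrM ler_piMl//; have /andP[W0 W1] := W01 m n z.
  by rewrite ger0_norm.
have gc m n : dot (g m) (g n) = c m n.
  apply: has_integral_uniq ((gP m).2 _ (gP n).1) _.
  apply: has_integral_iterated (cI m n) _ => x.
  apply: has_integral_ext (has_integralZ (w m x) (gE n x)) => y.
  by rewrite /W/= mulrA.
(* The inequality [1 - a b <= (1 - a) + (1 - b)] on [0, 1] separates the two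
   truncation levels, so that one sequence [e] bounds all errors. *)
pose V n (z : X * X) := ((1 - w n z.1) + (1 - w n z.2)) * `|k z.1 z.2|.
pose e n := \int[(P \x P)%E]_z V n z.
have V2 n z : `|V n z| <= 2 * `|k z.1 z.2|.
  rewrite /V normrM normr_id ler_wpM2r// ler_norml.
  by have /andP[? ?] := w01 n z.1; have /andP[? ?] := w01 n z.2; lra.
have eI n : has_integral (P \x P)%E (V n) (e n).
  apply: (has_integral_dominated (has_integralZ 2 knI)) => //.
  apply: measurable_funM; last exact: measurableT_comp.
  by apply: measurable_funD; apply: measurable_funB.
have e0 : e @ \oo --> (0 : R).
  apply: (has_integral_cvg eI (has_integral0 _) (has_integralZ 2 knI)) => // z.
  rewrite -[X in _ --> X](mul0r `|k z.1 z.2|); apply: cvgM; last exact: cvg_cst.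
  rewrite -[X in _ --> X](_ : (1 - 1) + (1 - 1) = 0 :> R); last by ring.
  by apply: cvgD; (apply: cvgB; [exact: cvg_cst|exact: w1]).
have ce m n : `|I - c m n| <= e m + e n.
  apply: has_integral_norm_le (has_integralB kI (cI m n))
    (has_integralD (eI m) (eI n)) _.
  move=> z; rewrite -{1}(mul1r (k _ _)) -mulrBl normrM -mulrDl ler_wpM2r//.
  rewrite /W ger0_norm; last by have /andP[_] := W01 m n z; rewrite subr_ge0.
  have /andP[? ?] := w01 m z.1; have /andP[? ?] := w01 n z.2.
  by have /andP[? ?] := w01 m z.2; have /andP[? ?] := w01 n z.1; nra.
have gnorm n : `|g n| ^+ 2 = c n n by rewrite norm gc.
have gcvg : cvgn g.
  apply: (sqr_norm_cauchy (e := fun n => 4 * e n)); last first.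
    by rewrite -(mulr0 4); apply: cvgM => //; exact: cvg_cst.
  move=> m n; rewrite (sqr_normB norm) !gnorm gc.
  have := ce m m; have := ce n n; have := ce m n; rewrite !ler_norml /=.
  by move=> /andP[? ?] /andP[? ?] /andP[? ?]; lra.
(* Elements of the space are determined by their values. *)
have limE : limn g = Pk.
  apply/rk_eval_inj/funext => y.
  have g1 : rk_eval (g n) y @[n --> \oo] --> rk_eval (limn g) y.
    exact: rk_eval_cvg.
  have g2 : rk_eval (g n) y @[n --> \oo] --> rk_eval Pk y.
    apply: (has_integral_cvg (gE^~ y) (kP y)
      (integrable_has_integral (integrable_norm (kP y).1))).
    - move=> n x /=; rewrite normrM ler_piMl//; have /andP[? ?] := w01 n x.
      by rewrite ger0_norm.
    - move=> x; rewrite -[X in _ --> X]mul1r; apply: cvgM; last exact: cvg_cst.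
      exact: w1.
  exact: (cvg_unique _ g1 g2).
have n1 : c n n @[n --> \oo] --> `|Pk| ^+ 2.
  under eq_fun do rewrite -gnorm expr2.
  by rewrite -limE expr2; apply: cvgM; exact: cvg_norm.
have n2 : c n n @[n --> \oo] --> I.
  apply/subr_cvg0; apply: norm_cvg0.
  apply: (@squeeze_cvgr _ _ _ _ (fun=> 0) (fun n => 2 * e n)); last 2 first.
    exact: cvg_cst.
    by rewrite -(mulr0 2); apply: cvgM => //; exact: cvg_cst.
  by apply: nearW => n; rewrite normr_ge0 distrC; have := ce n n => /=; lra.
by rewrite (cvg_unique _ n1 n2).
Unshelve. all: by end_near. Qed.

End MeanEmbedding.

(** * Optimal weights at given points *)

Section Quantization.
Context {R : realType} {d : measure_display} {X : measurableType d}.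
Context {k : X -> X -> R} (H : rkhs k) {n : nat}.
Implicit Types (p q : 'cV[R]_n) (x : 'I_n -> X) (f : H).
Local Notation dot := (rk_dot H).
Local Notation phi := (rk_ker H).
Local Notation norm := (@rk_norm R X k H).
Local Notation disc := (discrete_embedding H).
Local Notation one := (ones R n).

Lemma kermat_sym x : (kermat k x)^T = kermat k x.
Proof. by apply/matrixP => i j; rewrite !mxE (rk_kerC H). Qed.

Lemma invmx_kermat_sym x : (invmx (kermat k x))^T = invmx (kermat k x).
Proof. by rewrite trmx_inv kermat_sym. Qed.

Lemma sum_oneE p : \sum_i p i 0 = (one^T *m p) 0 0.
Proof. by rewrite mxE; apply: eq_bigr => i _; rewrite !mxE mul1r. Qed.

Lemma dot_discrete f p x : dot f (disc p x) = \sum_i p i 0 * rk_eval f (x i).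
Proof.
rewrite /discrete_embedding dot_sumr; apply: eq_bigr => i _.
by rewrite (dotZr (rk_dot H)) rk_reproducing.
Qed.

Lemma rk_eval_discrete p x i : rk_eval (disc p x) (x i) = (kermat k x *m p) i 0.
Proof.
rewrite -rk_reproducing (dotC (rk_dot H)) dot_discrete mxE; apply: eq_bigr => j _.
by rewrite mxE rk_kerE mulrC.
Qed.

(** With [v = K^-1 1], it is the squared norm of [sum_i v_i k(x_i, .)], a function
    that takes the value 1 at every [x_i] and so is not zero. *)
Lemma invmx_kermat_ones_gt0 x : (0 < n)%N -> kermat k x \in unitmx ->
  0 < (one^T *m invmx (kermat k x) *m one) 0 0.
Proof.
move=> n0 Ku; set Ki := invmx _.
pose v := Ki *m one.
have Kv : kermat k x *m v = one by rewrite mulmxA mulmxV// mul1mx.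
have -> : (one^T *m Ki *m one) 0 0 = `|disc v x| ^+ 2.
  rewrite norm dot_discrete -mulmxA -sum_oneE; apply: eq_bigr => i _.
  by rewrite rk_eval_discrete Kv [X in _ * X]mxE mulr1.
rewrite exprn_gt0// normr_gt0; apply/eqP => v0.
have := rk_eval_discrete v x (Ordinal n0).
by rewrite Kv v0 mxE -rk_reproducing linear0l => /eqP; rewrite eq_sym oner_eq0.
Qed.

Definition mean_vec f x : 'cV[R]_n := \col_i rk_eval f (x i).

(** The Lagrange multiplier of the constraint [sum_i p_i = 1]. *)
Definition multiplier f x : R :=
  (1 - (one^T *m invmx (kermat k x) *m mean_vec f x) 0 0)
  / (one^T *m invmx (kermat k x) *m one) 0 0.

Definition opt_weights f x : 'cV[R]_n :=
  invmx (kermat k x) *m (mean_vec f x + multiplier f x *: one).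

(** The minimal squared error; its last summand is the quotient
    [(1 - 1^T K^-1 b)^2 / (1^T K^-1 1)] of the averaged cost function. *)
Definition opt_value f x : R :=
  `|f| ^+ 2 - ((mean_vec f x)^T *m invmx (kermat k x) *m mean_vec f x) 0 0
  + multiplier f x * (1 - (one^T *m invmx (kermat k x) *m mean_vec f x) 0 0).

Section Optimality.
Variables (f : H) (x : 'I_n -> X).
Hypotheses (n_gt0 : (0 < n)%N) (Ku : kermat k x \in unitmx).
Let Ki := invmx (kermat k x).
Let lam := multiplier f x.
Let ps := opt_weights f x.

Lemma opt_weights_sum_one : sum_one ps.
Proof.
rewrite /sum_one sum_oneE /ps /opt_weights mulmxA mulmxDr -scalemxAr mxE.
rewrite [X in _ + X]mxE.
by rewrite divfK ?gt_eqF ?invmx_kermat_ones_gt0// addrC subrK.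
Qed.

(** The stationarity condition [K p - b = lam 1], read in the function space. *)
Lemma rk_eval_opt_residual i : rk_eval (f - disc ps x) (x i) = - lam.
Proof.
rewrite rk_evalB rk_eval_discrete /ps /opt_weights mulmxA mulmxV// mul1mx.
by rewrite -/lam !mxE mulr1; ring.
Qed.

Lemma dot_opt_residual p : dot (f - disc ps x) (disc p x) = - lam * \sum_i p i 0.
Proof.
rewrite dot_discrete mulr_sumr; apply: eq_bigr => i _.
by rewrite rk_eval_opt_residual mulrC.
Qed.

(** Pythagoras: the residual of [ps] is orthogonal to [disc ps x - disc q x], since
    by [dot_opt_residual] its inner products only see the sum of the weights. *)
Lemma quant_error_split q : sum_one q ->
  quant_error f q x ^+ 2 = quant_error f ps x ^+ 2 + `|disc ps x - disc q x| ^+ 2.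
Proof.
move=> q1; rewrite /quant_error.
have -> : f - disc q x = (f - disc ps x) + (disc ps x - disc q x).
  by rewrite addrA subrK.
rewrite (sqr_normD norm (f - _)).
rewrite (dotBr (rk_dot H)) !dot_opt_residual q1 opt_weights_sum_one.
by rewrite subrr mulr0 addr0.
Qed.

Lemma quant_error_opt : quant_error f ps x ^+ 2 = opt_value f x.
Proof.
rewrite /quant_error norm [in LHS](dotBr (rk_dot H)) dot_opt_residual.
rewrite opt_weights_sum_one mulr1 opprK (dotBl (rk_dot H)) -norm /opt_value -/lam.
rewrite (dotC (rk_dot H)) dot_discrete.
have -> : \sum_i ps i 0 * rk_eval f (x i) = ((mean_vec f x)^T *m ps) 0 0.
  by rewrite mxE; apply: eq_bigr => i _; rewrite !mxE mulrC.
rewrite /ps /opt_weights mulmxA mulmxDr -scalemxAr -/lam -/Ki.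
have -> : (mean_vec f x)^T *m Ki *m one = (one^T *m Ki *m mean_vec f x)^T.
  by rewrite !trmx_mul trmxK invmx_kermat_sym mulmxA.
by rewrite [X in _ - X]mxE [X in _ - (_ + X)]mxE [X in _ - (_ + _ * X)]mxE; ring.
Qed.

End Optimality.

(** The cost is [k(xi, xi')] plus a bilinear and a product term in the vectors
    [k(xi, x)] and [k(xi', x)]: integration replaces each vector by its mean. *)
Lemma expected_costE (P : probability X R) f x :
  kernel_embedding P f ->
  (P \x P)%E.-integrable [set: X * X] (fun z => (k z.1 z.2)%:E) ->
  expected_cost k P x = (opt_value f x)%:E.
Proof.
move=> fE kint; rewrite /expected_cost expectation.unlock.
have kI := mean_embedding_norm fE kint.
have vI (a : 'rV[R]_n) : has_integral P (fun y => (a *m kervec k x y) 0 0)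
    ((a *m mean_vec f x) 0 0).
  rewrite mxE; apply: has_integral_ext (has_integral_sum
    (c := fun i => a 0 i * mean_vec f x i 0)
    (f := fun i y => a 0 i * k (x i) y) _ _) => [y|i].
    by rewrite mxE; apply: eq_bigr => i _; rewrite mxE (rk_kerC H).
  apply: has_integralZ; rewrite mxE.
  by have [Iy yE] := fE (x i); split; rewrite ?yE.
set Ki := invmx (kermat k x).
have qI : has_integral (P \x P)%E
    (fun z => ((kervec k x z.1)^T *m Ki *m kervec k x z.2) 0 0)
    (((mean_vec f x)^T *m Ki *m mean_vec f x) 0 0).
  rewrite mxE.
  apply: has_integral_ext (has_integral_sum
    (c := fun j => ((mean_vec f x)^T *m Ki) 0 j * mean_vec f x j 0)
    (f := fun j z => ((kervec k x z.1)^T *m Ki) 0 j * kervec k x z.2 j 0)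
    _ _) => [z|j].
    by rewrite mxE.
  have vj : has_integral P (fun y => kervec k x y j 0) (mean_vec f x j 0).
    have := vI (delta_mx 0 j); rewrite -rowE mxE.
    by apply: has_integral_ext => y; rewrite -rowE mxE.
  apply: (has_integral_prod (f := fun y => ((kervec k x y)^T *m Ki) 0 j) _ vj).
  have tE (v : 'cV[R]_n) : (v^T *m Ki) 0 j = ((col j Ki)^T *m v) 0 0.
    by rewrite -[v in RHS]trmxK -trmx_mul [RHS]mxE colE mulmxA -colE [RHS]mxE.
  by rewrite tE; apply: has_integral_ext (vI (col j Ki)^T) => y; rewrite tE.
have uI := has_integralB (has_integral_cst P 1) (vI (one^T *m Ki)).
have [_ costI] := has_integralD (has_integralB kI qI)
  (has_integralZ (1 / (one^T *m Ki *m one) 0 0) (has_integral_prod uI uI)).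
have -> : opt_value f x =
     `|f| ^+ 2 - ((mean_vec f x)^T *m Ki *m mean_vec f x) 0 0 +
     1 / (one^T *m Ki *m one) 0 0 *
     ((1 - (one^T *m Ki *m mean_vec f x) 0 0) *
      (1 - (one^T *m Ki *m mean_vec f x) 0 0)).
  by rewrite /opt_value /multiplier -/Ki; ring.
by rewrite -costI; apply: eq_integral => z _; rewrite /cost -/Ki mulrA.
Qed.

(** The discrete measure has at most [n] atoms once equal ones are merged; points
    of [x0] with weight zero complete them to [n] distinct points. *)
Lemma merge_atoms p x : (exists x0 : 'I_n -> X, injective x0) ->
  exists q y, [/\ injective y, disc q y = disc p x,
    sum_one p -> sum_one q & simplex p -> simplex q].
Proof.
move=> [x0 x0inj].
(* [t] lists the distinct [x i] first: they are all among its first [n] entries. *)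
pose u := undup (codom x).
pose t := u ++ [seq a <- codom x0 | a \notin u].
have ut : uniq t.
  rewrite cat_uniq undup_uniq filter_uniq ?andbT/=; last first.
    by rewrite /codom map_inj_uniq ?enum_uniq.
  by apply/hasPn => a; rewrite mem_filter => /andP[].
have un : (size u <= n)%N.
  by apply: leq_trans (size_undup _) _; rewrite size_codom card_ord.
have tn : (n <= size t)%N.
  rewrite -[n in (n <= _)%N]card_ord -(size_codom x0); apply: uniq_leq_size.
    by rewrite /codom map_inj_uniq ?enum_uniq.
  move=> a ax0; rewrite mem_cat mem_filter ax0 andbT.
  by case: (a \in u).
have nth_lt (i : 'I_n) : (i < size t)%N by exact: leq_trans tn.
case: (posnP n) => [n0|npos].
  by exists p, x; split=> // i; have := ltn_ord i; rewrite {2}n0 ltn0.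
pose a0 := x (Ordinal npos).
pose y (i : 'I_n) := nth a0 t i.
have yinj : injective y.
  by move=> i j /eqP; rewrite nth_uniq// => /eqP/val_inj.
have yx j : exists i, x j = y i.
  have xju : x j \in u by rewrite mem_undup codom_f.
  have idx : (index (x j) u < n)%N by apply: leq_trans un; rewrite index_mem.
  by exists (Ordinal idx); rewrite /y nth_cat /= index_mem xju nth_index.
have /choice [s xs] := yx.
pose q : 'cV[R]_n := \col_i \sum_(j | s j == i) p j 0.
have q1 : \sum_i q i 0 = \sum_j p j 0.
  rewrite [RHS](partition_big s xpredT)//=; apply: eq_bigr => i _.
  by rewrite mxE.
exists q, y; split=> //.
- rewrite /discrete_embedding [RHS](partition_big s xpredT)//=.
  apply: eq_bigr => i _; rewrite mxE scaler_suml.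
  by apply: eq_bigr => j /eqP <-; rewrite xs.
- by rewrite /sum_one q1.
- rewrite /simplex /sum_one q1 => -[p1 p0]; split=> // i.
  by rewrite mxE sumr_ge0.
Qed.

End Quantization.

(** * Comparison of the two problems *)

Section QuantInf.
Context {R : realType} {X : Type} {k : X -> X -> R} (H : rkhs k) {n : nat}.
Implicit Types (f : H) (F : 'cV[R]_n -> Prop).

Lemma quant_inf_le f F p x : F p -> quant_inf f F <= quant_error f p x.
Proof.
move=> Fp; apply: ge_inf; last by exists p, x.
by exists 0 => _ [q [y [_ ->]]]; exact: normr_ge0.
Qed.

Lemma le_quant_inf f F (c : R) : (exists p (x : 'I_n -> X), F p) ->
  (forall p x, F p -> c <= quant_error f p x) -> c <= quant_inf f F.
Proof.
move=> [p [x Fp]] cF; apply: lb_le_inf; first by exists (quant_error f p x), p, x.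
by move=> _ [q [y [Fq ->]]]; exact: cF.
Qed.

End QuantInf.

Theorem theorem7 (R : realType) (d : measure_display) (X : measurableType d)
  (k : X -> X -> R) (H : rkhs k) (P : probability X R) (Pk : H)
  (n : nat) (n_gt0 : (0 < n)%N)
  (Pk_embedding : kernel_embedding P Pk)
  (k_integrable :
     (P \x P)%E.-integrable [set: X * X] (fun z => (k z.1 z.2)%:E))
  (kermat_unit : forall x : 'I_n -> X, injective x -> kermat k x \in unitmx)
  (enough_points : exists x : 'I_n -> X, injective x) :
  [/\ forall x : 'I_n -> X, cost_dom k x ->
        (exists2 p, sum_one p &
           (quant_error Pk p x ^+ 2)%:E = expected_cost k P x) /\
        (forall p, sum_one p ->
           (expected_cost k P x <= (quant_error Pk p x ^+ 2)%:E)%E),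
      cost_inf k P n = (quant_inf Pk (@sum_one R n) ^+ 2)%:E &
      sign_constraint_inactive n Pk ->
        cost_inf k P n = (quant_inf Pk (@simplex R n) ^+ 2)%:E /\
        (forall (p : 'cV[R]_n) (x : 'I_n -> X), cost_dom k x ->
           (quant_solution Pk p x <->
            [/\ cost_solution k P x, simplex p &
                (quant_error Pk p x ^+ 2)%:E = expected_cost k P x]))].
Proof.
have costE (x : 'I_n -> X) := expected_costE x Pk_embedding k_integrable.
have cost_attained (x : 'I_n -> X) : cost_dom k x -> exists2 p, sum_one p &
    (quant_error Pk p x ^+ 2)%:E = expected_cost k P x.
  move=> xu; exists (opt_weights Pk x).
    exact: (opt_weights_sum_one Pk n_gt0 xu).
  by rewrite costE quant_error_opt.
have cost_le (x : 'I_n -> X) p : cost_dom k x -> sum_one p ->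
    (expected_cost k P x <= (quant_error Pk p x ^+ 2)%:E)%E.
  move=> xu p1; rewrite costE lee_fin (quant_error_split Pk n_gt0 xu p1).
  by rewrite quant_error_opt// lerDl sqr_ge0.
set m := quant_inf Pk _.
have [x0 x0inj] := enough_points.
have [p0 p01 _] := cost_attained _ (kermat_unit _ x0inj).
have m_ge0 : 0 <= m.
  by apply: le_quant_inf => [|p x _]; [exists p0, x0|exact: normr_ge0].
have cost_ge (x : 'I_n -> X) :
    cost_dom k x -> ((m ^+ 2)%:E <= expected_cost k P x)%E.
  move=> /cost_attained[p p1 <-]; rewrite lee_fin lerXn2r ?nnegrE ?normr_ge0//.
  exact: quant_inf_le.
have infE : cost_inf k P n = (m ^+ 2)%:E.
  apply/eqP; rewrite eq_le; apply/andP; split; last first.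
    by apply/ereal_infP => _ [x xu <-]; exact: cost_ge.
  (* Points with a singular kernel matrix also count in [quant_inf]. *)
  have inf_le p (x : 'I_n -> X) : sum_one p ->
      (cost_inf k P n <= (quant_error Pk p x ^+ 2)%:E)%E.
    move=> p1; have [q [y [yinj qE q1 _]]] := merge_atoms H p x enough_points.
    rewrite /quant_error -qE.
    apply: le_trans (cost_le _ _ (kermat_unit _ yinj) (q1 p1)).
    apply: ge_ereal_inf; exists (expected_cost k P y) => //.
    by exists y => //; exact: kermat_unit.
  have : ((m ^+ 2)%:E <= cost_inf k P n)%E.
    by apply/ereal_infP => _ [x xu <-]; exact: cost_ge.
  have := inf_le p0 x0 p01.
  move: inf_le; case: (cost_inf k P n) => [c| |] inf_le //.
  rewrite !lee_fin => _ mc.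
  have c_ge0 : 0 <= c by apply: le_trans mc; exact: sqr_ge0.
  rewrite -(sqr_sqrtr c_ge0) lerXn2r ?nnegrE ?sqrtr_ge0//.
  apply: le_quant_inf; first by exists p0, x0.
  move=> p x p1; rewrite -(@ler_pXn2r _ 2)// ?nnegrE ?sqrtr_ge0// ?normr_ge0//.
  by rewrite sqr_sqrtr// -lee_fin inf_le.
split=> //.
  by move=> x xu; split; [exact: cost_attained|move=> p; exact: cost_le].
rewrite /sign_constraint_inactive -/m => mE; split; first by rewrite mE.
move=> p x xu; split=> [[ps pmin]|[[_ xmin] ps pE]].
- have em : quant_error Pk p x ^+ 2 <= m ^+ 2.
    rewrite lerXn2r ?nnegrE ?normr_ge0// -mE; apply: le_quant_inf; last exact: pmin.
    by exists p, x.
  have pE : (quant_error Pk p x ^+ 2)%:E = expected_cost k P x.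
    apply/eqP; rewrite eq_le; apply/andP; split; last exact: cost_le ps.1.
    by apply: le_trans (cost_ge _ xu); rewrite lee_fin.
  split=> //; split=> // y yu; rewrite -pE.
  by apply: le_trans (cost_ge _ yu); rewrite lee_fin.
- split=> // q y qs; rewrite -(@ler_pXn2r _ 2)// ?nnegrE ?normr_ge0//.
  rewrite -lee_fin pE; apply: (@le_trans _ _ (m ^+ 2)%:E).
    by rewrite -infE; apply/ereal_infP => _ [z zu <-]; exact: xmin.
  rewrite lee_fin lerXn2r ?nnegrE ?normr_ge0// -mE; exact: quant_inf_le.
Qed.
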